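(* Let $G$ be a finite simple graph and $s \geq 1$ an integer. Then \[ N(G,K_s) \leq \sum_{v \in V(G)} \frac{1}{p(v)+1}\binom{p(v)+1}{s} = \frac{1}{s}\sum_{v \in V(G)}\binom{p(v)}{s-1}. \] If $s=1$, equality always holds. Otherwise (i.e. for $s\geq 2$), equality holds if and only if every connected component of the induced subgraph $G[H_p]$ is a clique, where $H_p = \{v \in V(G) \mid p(v) \geq s-1\}$.
   Context: $N(G,K_s)$ denotes the number of subgraphs of $G$ isomorphic to $K_s$. For $v \in V(G)$, $p(v)$ is the length (number of edges) of the longest path in $G$ containing $v$ (so $p(v)=0$ for an isolated vertex). Binomial coefficients $\binom{a}{b}$ are $0$ when $a<b$. *)

(* Defs.v *)
From mathcomp Require Import all_boot all_order all_algebra.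

Set Implicit Arguments.
Unset Strict Implicit.
Unset Printing Implicit Defensive.

(* Written in the MathComp world. A finite simple graph is a symmetric and
   irreflexive relation on a finType; an edge is the two-element set of its
   endpoints. *)

Definition edge_set (T : finType) (e : rel T) : {set {set T}} :=
  [set [set xy.1; xy.2] | xy : T * T & e xy.1 xy.2].

(* A candidate subgraph is a pair (vertex set, edge set); it need not be
   induced. *)
Definition is_subgraph (T : finType) (e : rel T)
    (H : {set T} * {set {set T}}) : bool :=
  (H.2 \subset edge_set e) && [forall F in H.2, F \subset H.1].

(* When H is a subgraph of a simple graph, its edges are two-element subsets of
   H.1 = f(U), so the last clause determines H.2 completely. *)
Definition isomorphic_to (U T : finType) (r : rel U)
    (H : {set T} * {set {set T}}) : bool :=
  [exists f : {ffun U -> T},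
    [&& injectiveb f, f @: [set: U] == H.1 &
        [forall x, forall y, r x y == ([set f x; f y] \in H.2)]]].

Definition num_copies (T U : finType) (e : rel T) (r : rel U) : nat :=
  #|[set H : {set T} * {set {set T}} | is_subgraph e H && isomorphic_to r H]|.

Definition complete_graph (s : nat) : rel 'I_s := fun i j => i != j.
Arguments complete_graph s : clear implicits.

(* A path with n edges is a duplicate-free sequence of n.+1 consecutively
   adjacent vertices; having distinct vertices forces n < #|T|, so the range of
   the maximum excludes no path. *)
Definition longest_path (T : finType) (e : rel T) (v : T) : nat :=
  \max_(n < #|T| | [exists t : n.+1.-tuple T,
                      [&& sorted e t, uniq t & v \in t]]) n.

Definition induced (T : finType) (e : rel T) (A : {set T}) :
  rel {x : T | x \in A} := relpre val e.
Arguments induced {T} e A.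

Definition components (T : finType) (e : rel T) : {set {set T}} :=
  equivalence_partition (connect e) [set: T].

Definition is_clique (T : finType) (e : rel T) (C : {set T}) : Prop :=
  {in C &, forall x y, x != y -> e x y}.

(* Main.v *)
(* Induction on the number of edges. Let P be a longest path of the graph, with
   k edges. If no edge leaves V(P), delete V(P): at most C(k+1, s) copies of K_s
   are lost, which is exactly the contribution of V(P) to the bound. Otherwise
   V(P) carries no Hamiltonian cycle, so by the usual crossing-chord argument
   the degrees of the two ends of P add up to at most k; delete an end u with
   d(u) <= k/2, which loses at most C(d(u), s-1) <= C(k, s-1)/s copies.

   For the equality case, "the components of G[H_p] are cliques" means that
   adjacency is transitive on H_p. Deleting an end u as above is never tight when
   k >= s-1: the neighbour y of u on P would keep p(y) = k after the deletion, so
   by induction y would lie in a clique with k+1 vertices, and prepending u to a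
   Hamiltonian path of this clique that starts at y beats P. *)

Require Import Defs.
From mathcomp Require Import all_boot all_order all_algebra.
From mathcomp Require Import zify.

Set Implicit Arguments.
Unset Strict Implicit.
Unset Printing Implicit Defensive.

(** Vandermonde writes ['C(d.*2, t)] as a sum of [t.+1] products ['C(d, i) * 'C(d, t - i)]. Each is
    at least ['C(d, i) * 'C(d - i, t - i) = 'C(d, t) * 'C(t, i)], hence at least ['C(d, t)]. *)
Lemma leq_mul_bin_double (d t : nat) : t.+1 * 'C(d, t) <= 'C(d.*2, t).
Proof.
case: (leqP t d) => [le_td|lt_dt]; last by rewrite bin_small // muln0.
have -> : t.+1 * 'C(d, t) = \sum_(i < t.+1) 'C(d, t).
  by rewrite sum_nat_const card_ord.
rewrite -addnn -binomial.Vandermonde.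
apply: leq_sum => i _; have le_it : i <= t by rewrite -ltnS.
have tr : 'C(d, i) * 'C(d - i, t - i) = 'C(d, t) * 'C(t, i).
  have le_id := leq_trans le_it le_td.
  have fact_pos : 0 < i`! * (t - i)`! * (d - t)`! by rewrite !muln_gt0 !fact_gt0.
  apply/eqP; rewrite -(eqn_pmul2r fact_pos); apply/eqP.
  have := bin_fact le_id; have := bin_fact le_it; have := bin_fact le_td.
  have : t - i <= d - i by lia.
  move=> /bin_fact; rewrite (_ : d - i - (t - i) = d - t); last by lia.
  nia.
apply: (@leq_trans ('C(d, t) * 'C(t, i))).
  by rewrite leq_pmulr // bin_gt0.
by rewrite -tr leq_mul2l leq_bin2l ?leq_subr ?orbT.
Qed.

Lemma ltn_bin2l (m n t : nat) : 0 < t -> t <= n -> m < n -> 'C(m, t) < 'C(n, t).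
Proof.
case: t => // t _; case: n => // n le_tn lt_mn.
rewrite binS -[X in X < _]addn0 -addnS leq_add ?leq_bin2l //.
by rewrite bin_gt0.
Qed.

Lemma set2_eq (T : finType) (x y a b : T) :
  [set x; y] = [set a; b] -> (x = a /\ y = b) \/ (x = b /\ y = a).
Proof.
move=> /setP E; move: (E x) (E y) (E a) (E b); rewrite !inE !eqxx ?orbT /=.
move=> /esym/orP[]/eqP -> /esym/orP[]/eqP ->; rewrite ?eqxx ?orbT ?orbb.
- by move=> _ /eqP ->; left.
- by left.
- by right.
- by move=> /eqP -> _; left.
Qed.

(** * Copies of complete graphs as cliques, and basic facts on longest paths *)

Section Graph.
Variable T : finType.
Implicit Types (e : rel T) (A S : {set T}) (q : seq T) (u v x y z : T).

Definition cliqueb e A :=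
  [forall x in A, forall y in A, (x != y) ==> e x y].

Lemma cliqueP e A : reflect (is_clique e A) (cliqueb e A).
Proof.
apply: (iffP forall_inP) => [H x y xA yA nxy|H x xA].
  by move: (H x xA) => /forall_inP/(_ y yA)/implyP; apply.
by apply/forall_inP => y yA; apply/implyP; apply: H.
Qed.

Definition cliques e s := [set A : {set T} | (#|A| == s) && cliqueb e A].

(** The edges of the complete graph on [A], in the format of [edge_set]. *)
Definition pairs A : {set {set T}} :=
  [set [set xy.1; xy.2] | xy : T * T & [&& xy.1 \in A, xy.2 \in A & xy.1 != xy.2]].

Lemma pairsE A x y : ([set x; y] \in pairs A) = [&& x \in A, y \in A & x != y].
Proof.
apply/imsetP/idP => [[[a b]]|H]; last by exists (x, y); rewrite ?inE.
rewrite inE /= => /and3P[aA bA nab] /set2_eq[[-> ->]|[-> ->]].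
  by rewrite aA bA nab.
by rewrite aA bA eq_sym nab.
Qed.

(** Irreflexivity of [e] makes the ends of each edge of [H] distinct; conversely [f] maps onto the
    vertices of [H], so any two of them come from distinct indices. A copy is thus determined by its
    vertex set. *)
Lemma copy_edges e s (H : {set T} * {set {set T}}) :
  irreflexive e -> is_subgraph e H -> isomorphic_to (complete_graph s) H ->
  H.2 = pairs H.1.
Proof.
move=> e_irr /andP[/subsetP sub /forall_inP subF].
case/existsP=> f /and3P[/injectiveP f_inj /eqP fH /forallP adj].
apply/setP => F; apply/idP/idP => [FH|/imsetP[[x y]]].
  have /imsetP[[x y]] := sub _ FH; rewrite inE /= => exy FE.
  move/subsetP: (subF _ FH) => FsubH.
  rewrite FE pairsE !FsubH ?FE ?inE ?eqxx ?orbT //=.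
  by apply: contraTneq exy => ->; rewrite e_irr.
rewrite inE /= -fH => /and3P[/imsetP[i _ ->] /imsetP[j _ ->] nij] ->.
move/forallP: (adj i) => /(_ j) /eqP <-.
by apply: contra nij => /eqP ->.
Qed.

(** By [copy_edges] the first projection is injective on copies, and its image consists of the
    cliques of size [s]. *)
Lemma num_copiesE e s : symmetric e -> irreflexive e ->
  num_copies e (complete_graph s) = #|cliques e s|.
Proof.
move=> e_sym e_irr; rewrite /num_copies.
set Hs := [set H | _]; have fst_inj : {in Hs &, injective fst}.
  move=> [A E] [A' E']; rewrite !inE => /andP[] sub /(copy_edges e_irr sub) /= ->.
  by move=> /andP[] sub' /(copy_edges e_irr sub') /= -> ->.
rewrite -(card_in_imset fst_inj); apply: eq_card => A.
apply/imsetP/idP => [[[B E]]|].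
  rewrite inE => /andP[sub iso] /= ->; have /= EB := copy_edges e_irr sub iso.
  rewrite inE; apply/andP; split.
    case/existsP: iso => f /and3P[/injectiveP f_inj /eqP /= <- _].
    by rewrite card_imset // cardsT card_ord.
  apply/cliqueP => x y xB yB nxy; case/andP: sub => /= /subsetP sub _.
  have : [set x; y] \in E by rewrite EB pairsE xB yB.
  move/sub/imsetP=> [[a b]]; rewrite inE /= => eab /set2_eq[[-> ->]|[-> ->]] //.
  by rewrite e_sym.
rewrite inE => /andP[/eqP sA /cliqueP clA].
exists (A, pairs A) => //; rewrite inE; apply/andP; split.
  apply/andP; split; [apply/subsetP|apply/forall_inP] => F /imsetP[[x y]].
    rewrite inE /= => /and3P[xA yA nxy] ->; apply/imsetP; exists (x, y) => //.
    by rewrite inE /=; apply: clA.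
  rewrite inE /= => /and3P[xA yA nxy] ->.
  by apply/subsetP => z; rewrite !inE => /orP[]/eqP ->.
(* Replacing [s] by [#|A|] lets [enum_val] serve as the isomorphism. *)
case: s / sA {Hs fst_inj}; apply/existsP; exists [ffun i => enum_val i].
have f_inj : injective [ffun i : 'I_#|A| => enum_val i].
  by move=> i j; rewrite !ffunE => /enum_val_inj.
apply/and3P; split; first exact/injectiveP.
  rewrite eqEcard (card_imset _ f_inj) cardsT card_ord leqnn andbT.
  by apply/subsetP => x /imsetP[i _ ->]; rewrite ffunE enum_valP.
apply/forallP => i; apply/forallP => j; rewrite pairsE !ffunE !enum_valP /=.
by rewrite (inj_eq enum_val_inj).
Qed.

Lemma leq_longest_path e q v :
  sorted e q -> uniq q -> v \in q -> size q <= (longest_path e v).+1.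
Proof.
move=> e_q uq vq; case sq: (size q) => [|n] //; rewrite ltnS.
have lt_nT : n < #|T| by rewrite -sq -(card_uniqP uq) max_card.
rewrite /longest_path (bigD1 (Ordinal lt_nT)) /= ?leq_maxl //.
have tq : size q == n.+1 by rewrite sq.
by apply/existsP; exists (Tuple tq); rewrite /= e_q uq vq.
Qed.

Lemma longest_path_witness e v : exists q,
  [/\ sorted e q, uniq q, v \in q & size q = (longest_path e v).+1].
Proof.
have T0 : 0 < #|T| by apply/card_gt0P; exists v.
(* The path reduced to [v] makes the range of the maximum nonempty, so the maximum is attained. *)
have P0 : [exists t : 1.-tuple T, [&& sorted e t, uniq t & v \in t]].
  by apply/existsP; exists [tuple v]; rewrite /= inE eqxx.
rewrite /longest_path (bigop.bigmax_eq_arg (Ordinal T0)) //.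
case: arg_maxnP => //= n /existsP[t /and3P[e_t ut vt]] _.
by exists t; rewrite size_tuple.
Qed.

Lemma longest_path_sub e e' v :
  subrel e' e -> longest_path e' v <= longest_path e v.
Proof.
move=> sub; have [q [e_q uq vq sq]] := longest_path_witness e' v.
by rewrite -ltnS -sq; apply: leq_longest_path => //; apply: sub_sorted e_q.
Qed.

Lemma longest_path_isolated e v :
  (forall x, ~~ e v x) -> (forall x, ~~ e x v) -> longest_path e v = 0.
Proof.
move=> out inn; have [q [e_q uq vq sq]] := longest_path_witness e v.
move: e_q sq; case/splitPr: vq => q1 [|y q2]; case: q1 => [|x q1] //=.
- by move=> _ [].
- by rewrite cat_path /= => /and3P[_ e_v _]; rewrite (negPf (inn _)) in e_v.
- by rewrite (negPf (out y)).
by rewrite cat_path /= => /and3P[_ e_v _]; rewrite (negPf (inn _)) in e_v.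
Qed.
End Graph.

(** * Ends of longest paths and crossing chords *)

Section LongestPath.
Variables (T : finType) (e : rel T).
Hypotheses (e_sym : symmetric e) (e_irr : irreflexive e).
Implicit Types (x y : T) (p q : seq T).

Definition nbh (r : rel T) x := [set y | r x y].

Lemma rev_upath x p : sorted e (x :: p) -> uniq (x :: p) ->
  exists p',
  [/\ sorted e (last x p :: p'), uniq (last x p :: p') & perm_eq (last x p :: p') (x :: p)].
Proof.
move=> e_p u_p; exists (behead (rev (x :: p))).
have E : last x p :: behead (rev (x :: p)) = rev (x :: p).
  by rewrite (lastI x p) rev_rcons.
rewrite E rev_uniq; split; rewrite ?perm_rev //.
by rewrite rev_sorted (eq_sorted (e' := e)) // => a b; rewrite e_sym.
Qed.

(** Opening the cycle at [a] gives a path that starts there, and [b] is prepended to it. *)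
Lemma cycle_extend q a b : ucycle e q -> a \in q -> b \notin q -> e a b ->
  exists q', [/\ sorted e q', uniq q' & size q' = (size q).+1].
Proof.
move=> /andP[e_q u_q] aq bq eab; have [i p rotq] := rot_to aq.
exists (b :: rot i q); split; last by rewrite /= size_rot.
  have := e_q; rewrite -(rot_cycle i) rotq /= rcons_path => /andP[-> _].
  by rewrite e_sym eab.
by rewrite /= rot_uniq mem_rot bq.
Qed.

(* Reversing the second segment of the path turns the two crossing chords into
   a Hamiltonian cycle of its vertex set. *)
Lemma crossing_cycle x p y q :
  sorted e (x :: p ++ y :: q) -> uniq (x :: p ++ y :: q) ->
  e x y -> e (last x p) (last y q) ->
  exists c, ucycle e c /\ perm_eq c (x :: p ++ y :: q).
Proof.
move=> e_pq u_pq exy ell; exists (x :: p ++ rev (y :: q)).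
have perm_c : perm_eq (x :: p ++ rev (y :: q)) (x :: p ++ y :: q).
  by rewrite perm_cons perm_cat2l perm_rev.
split=> //; rewrite /ucycle (perm_uniq perm_c) u_pq andbT /=.
move: e_pq; rewrite /= cat_path rcons_cat cat_path /= => /and3P[-> _ e_q] /=.
rewrite (lastI y q) rev_rcons /= ell /=.
have e_xq : path e x (y :: q) by rewrite /= exy.
rewrite -rev_path /= rev_cons in e_xq.
by rewrite (eq_path (e' := fun z => e^~ z)) // => a b; rewrite e_sym.
Qed.

Variable k : nat.
Hypothesis k_max : forall q, sorted e q -> uniq q -> size q <= k.+1.

(** A neighbour off the path could be prepended, against [k_max]. *)
Lemma nbh_end x p : sorted e (x :: p) -> uniq (x :: p) -> size p = k ->
  forall y, e x y -> y \in p.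
Proof.
move=> e_p u_p sp y exy; have nyx : y != x by apply: contraTneq exy => ->; rewrite e_irr.
apply: contraT => yp; have := @k_max (y :: x :: p).
rewrite /= sp ltnn e_sym exy; apply=> //.
by rewrite inE negb_or nyx yp.
Qed.

Lemma longest_path_dichotomy q : sorted e q -> uniq q -> size q = k.+1 ->
  (forall a b, a \in q -> e a b -> b \in q) \/
  exists x p, [/\ sorted e (x :: p), uniq (x :: p), size p = k & (#|nbh e x|).*2 <= k].
Proof.
case: q => [|x p] // e_p u_p [sp].
have [/forall_inP closed|] := boolP [forall a in x :: p, forall b, e a b ==> (b \in x :: p)].
  by left=> a b /closed/forallP/(_ b)/implyP; apply.
case/forall_inPn=> a ap /forallPn[b]; rewrite negb_imply => /andP[eab bp]; right.
have no_cycle c : ucycle e c -> perm_eq c (x :: p) -> False.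
  move=> cyc_c perm_c; have [||q [e_q u_q sq]] := cycle_extend (a := a) (b := b) cyc_c _ _ eab.
  - by rewrite (perm_mem perm_c).
  - by rewrite (perm_mem perm_c).
  by have := k_max e_q u_q; rewrite sq (perm_size perm_c) /= sp ltnn.
have [p' [e_p' u_p' perm_p']] := rev_upath e_p u_p.
have sp' : size p' = k by move/perm_size: perm_p' => /= [->].
set w := last x p in e_p' u_p' perm_p'.
(* The shift by one matters: [nth x p i] is the successor of [nth x (x :: p) i] on the path, so an
   index common to [I] and [J] is a pair of crossing chords. *)
pose I := [set i : 'I_k | e x (nth x p i)].
pose J := [set i : 'I_k | e (nth x (x :: p) i) w].
have cI : #|nbh e x| <= #|I|.
  apply: leq_trans (leq_imset_card (fun i : 'I_k => nth x p i) _).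
  apply: subset_leq_card; apply/subsetP => y; rewrite inE => exy.
  have yp := nbh_end e_p u_p sp exy.
  have lt_yk : index y p < k by rewrite -sp index_mem.
  by apply/imsetP; exists (Ordinal lt_yk); rewrite ?inE /= nth_index.
have cJ : #|nbh e w| <= #|J|.
  apply: leq_trans (leq_imset_card (fun i : 'I_k => nth x (x :: p) i) _).
  apply: subset_leq_card; apply/subsetP => y; rewrite inE => ewy.
  have yp : y \in x :: p.
    by rewrite -(perm_mem perm_p') inE (nbh_end e_p' u_p' sp' ewy) orbT.
  have nyw : y != w by apply: contraTneq ewy => ->; rewrite e_irr.
  (* Position [k] is that of [w] itself, which is not its own neighbour. *)
  have lt_yk : index y (x :: p) < k.
    have : index y (x :: p) < k.+1 by rewrite -sp -[(size p).+1]/(size (x :: p)) index_mem.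
    rewrite ltnS leq_eqVlt => /predU1P[yk|//]; case/eqP: nyw.
    by rewrite -(nth_index x yp) yk -sp (nth_last x (x :: p)).
  by apply/imsetP; exists (Ordinal lt_yk); rewrite ?inE /= -/(nth x (x :: p) _) nth_index // e_sym.
have disj : [disjoint I & J].
  apply/pred0P => i /=; rewrite !inE; apply/negP => /andP[exi eiw].
  have lt_ip : i < size p by rewrite sp.
  have pE : p = take i p ++ nth x p i :: drop i.+1 p by rewrite -drop_nth // cat_take_drop.
  have [||||c [cyc_c perm_c]] := @crossing_cycle x (take i p) (nth x p i) (drop i.+1 p).
  - by rewrite -pE.
  - by rewrite -pE.
  - by [].
  - have -> : last (nth x p i) (drop i.+1 p) = w by rewrite /w [in RHS]pE last_cat.
    suff -> : last x (take i p) = nth x (x :: p) i by [].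
    case: (i : nat) lt_ip => [|j] lt_jp; first by rewrite take0.
    by rewrite (take_nth x) 1?ltnW // last_rcons.
  by apply: no_cycle cyc_c _; rewrite pE.
have le_k : #|nbh e x| + #|nbh e w| <= k.
  apply: leq_trans (leq_add cI cJ) _.
  have -> : #|I| + #|J| = #|I :|: J| by apply/eqP; rewrite eq_sym (leq_card_setU I J).
  by rewrite -[X in _ <= X]card_ord max_card.
have [le_xw|le_wx] := leqP #|nbh e x| #|nbh e w|.
  by exists x, p; split=> //; lia.
by exists w, p'; split=> //; lia.
Qed.
End LongestPath.

(** * Counting cliques at a vertex and under vertex deletion *)

Section CliqueCounting.
Variable T : finType.
Implicit Types (e : rel T) (A B S : {set T}) (q : seq T) (v x y z : T).

Definition cliques_at e s v := [set A in cliques e s | v \in A].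

Lemma clique_sorted e q :
  uniq q -> {in q &, forall x y, x != y -> e x y} -> sorted e q.
Proof.
rewrite uniq_pairwise => u_q cl; apply: pairwise_sorted.
by apply: (sub_in_pairwise (P := mem q)) u_q => //; apply/allP.
Qed.

Lemma sum_cliques_at e s : \sum_v #|cliques_at e s v| = s * #|cliques e s|.
Proof.
transitivity (\sum_v \sum_(A in cliques e s | v \in A) 1).
  by apply: eq_bigr => v _; rewrite -sum1_card; apply: eq_bigl => A; rewrite inE.
rewrite (exchange_big_dep (mem (cliques e s))) => [|v A _ /andP[]] //=.
rewrite mulnC -sum_nat_const.
apply: eq_bigr => A AK; transitivity #|A|.
  by rewrite -sum1_card; apply: eq_bigl => v; rewrite /= AK.
by move: AK; rewrite inE => /andP[/eqP].
Qed.

(** Removing [v] sends these cliques injectively to [t]-subsets of its neighbourhood. *)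
Lemma card_cliques_at e t v : #|cliques_at e t.+1 v| <= 'C(#|nbh e v|, t).
Proof.
have inj : {in cliques_at e t.+1 v &, injective (fun A => A :\ v)}.
  move=> A B; rewrite !inE => /andP[_ vA] /andP[_ vB] E.
  by rewrite -(setD1K vA) E setD1K.
rewrite -(card_in_imset inj) -cards_draws; apply: subset_leq_card.
apply/subsetP => _ /imsetP[A Acl ->]; move: Acl; rewrite !inE.
move=> /andP[/andP[sA /cliqueP clA] vA]; apply/andP; split.
  apply/subsetP => z; rewrite !inE => /andP[nzv zA].
  by apply: clA => //; rewrite eq_sym.
by move: sA; rewrite (cardsD1 v) vA.
Qed.

Lemma card_cliques_at_ge e t v B : v \in B -> is_clique e B ->
  'C(#|B|.-1, t) <= #|cliques_at e t.+1 v|.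
Proof.
move=> vB clB; have -> : #|B|.-1 = #|B :\ v| by rewrite (cardsD1 v B) vB.
rewrite -cards_draws; set D := [set A | _].
have vND A : A \in D -> v \notin A.
  by rewrite inE => /andP[/subsetP sub _]; apply/negP => /sub; rewrite !inE eqxx.
have inj : {in D &, injective (fun A => v |: A)}.
  by move=> A A' /vND vA /vND vA' E; rewrite -(setU1K vA) E setU1K.
rewrite -(card_in_imset inj); apply: subset_leq_card.
apply/subsetP => _ /imsetP[A AD ->]; have vA := vND A AD.
move: AD; rewrite inE => /andP[/subsetP sub /eqP sA].
have subB : {subset v |: A <= B}.
  by move=> x; rewrite !inE => /predU1P[-> //|/sub]; rewrite !inE => /andP[].
rewrite !inE cardsU1 vA sA !eqxx /= ?andbT.
by apply/cliqueP => x y /subB xB /subB yB; apply: clB.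
Qed.

(** The equality condition with [t] for s-1, stated without subtypes or connectivity so that it
    passes through the induction; [trans_on_components] translates it back. *)
Definition trans_on e t := forall x y z,
  t <= longest_path e x -> t <= longest_path e y -> t <= longest_path e z ->
  e x y -> e y z -> x != z -> e x z.

(** A path on more than [t] vertices lies in H_p, where the reflexive closure of [e] is transitive;
    so consecutive adjacency becomes pairwise adjacency. *)
Lemma trans_on_path e t q : symmetric e -> trans_on e t ->
  sorted e q -> uniq q -> t < size q -> {in q &, forall x y, x != y -> e x y}.
Proof.
move=> e_sym tr e_q u_q lt_tq.
have le_p x : x \in q -> t <= longest_path e x.
  by move=> xq; rewrite -ltnS; apply: leq_trans lt_tq (leq_longest_path e_q u_q xq).
pose r := [rel x y | (x == y) || e x y].
have r_tr : {in q & &, transitive r}.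
  move=> y x z yq xq zq /= /predU1P[-> //|exy] /predU1P[<-|eyz].
    by rewrite exy orbT.
  by case: eqVneq => //= nxz; apply: tr exy eyz nxz; apply: le_p.
have r_q : sorted r q by apply: sub_sorted e_q => x y /= ->; rewrite orbT.
rewrite (sorted_pairwise_in r_tr) in r_q; last by apply/allP.
move=> x y xq yq nxy; have := r_q => /(pairwiseP x) r_nth.
have lt_i z : z \in q -> index z q \in gtn (size q) by rewrite inE index_mem.
case: (ltngtP (index x q) (index y q)) => [lt|lt|E].
- have := r_nth _ _ (lt_i _ xq) (lt_i _ yq) lt.
  by rewrite !nth_index //= (negPf nxy).
- have := r_nth _ _ (lt_i _ yq) (lt_i _ xq) lt.
  by rewrite !nth_index //= eq_sym (negPf nxy) e_sym.
- by case/eqP: nxy; rewrite -(nth_index x xq) E nth_index.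
Qed.

(** A longest path through [v] spans a clique, whose [t]-subsets avoiding [v] give enough cliques at
    [v]; summing over [v] counts each clique [t.+1] times. *)
Lemma trans_on_cliques e t : symmetric e -> trans_on e t ->
  \sum_v 'C(longest_path e v, t) <= t.+1 * #|cliques e t.+1|.
Proof.
move=> e_sym tr; rewrite -sum_cliques_at; apply: leq_sum => v _.
have [lt_pt|le_tp] := ltnP (longest_path e v) t; first by rewrite bin_small.
have [q [e_q u_q vq sq]] := longest_path_witness e v.
have cl_q : is_clique e [set x in q].
  move=> x y; rewrite !inE; apply: (trans_on_path e_sym tr e_q u_q).
  by rewrite sq ltnS.
have vq' : v \in [set x in q] by rewrite inE.
by have := card_cliques_at_ge t vq' cl_q; rewrite cardsE (card_uniqP u_q) sq.
Qed.

Definition isolate e S : rel T := fun x y => [&& e x y, x \notin S & y \notin S].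
Definition cliques_meeting e s S := [set A in cliques e s | ~~ [disjoint A & S]].

Lemma isolate_sub e S : subrel (isolate e S) e.
Proof. by move=> x y /and3P[]. Qed.

Lemma isolate_sym e S : symmetric e -> symmetric (isolate e S).
Proof. by move=> e_sym x y; rewrite /isolate e_sym [(x \notin S) && _]andbC. Qed.

Lemma card_cliques_isolate e s S :
  #|cliques e s| <= #|cliques_meeting e s S| + #|cliques (isolate e S) s|.
Proof.
rewrite -(cardsID [set A : {set T} | ~~ [disjoint A & S]] (cliques e s)).
apply: leq_add; apply: subset_leq_card; apply/subsetP => A.
  by rewrite !inE.
rewrite in_setD inE negbK => /andP[disj]; rewrite !inE => /andP[-> /cliqueP clA].
apply/cliqueP => x y xA yA nxy; rewrite /isolate clA //.
by rewrite !(disjointFr disj).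
Qed.

(* [S] is deleted from the graph by isolating its vertices, which then
   contribute [0] to the bound as [0 < t]. *)
Lemma isolate_bound e t S : 0 < t ->
  let e' := isolate e S in
  let p := longest_path e in
  let p' := longest_path e' in
  let M := t.+1 * #|cliques_meeting e t.+1 S| in
  M <= \sum_(v in S) 'C(p v, t) ->
  t.+1 * #|cliques e' t.+1| <= \sum_v 'C(p' v, t) ->
  t.+1 * #|cliques e t.+1| <= \sum_v 'C(p v, t) /\
  (t.+1 * #|cliques e t.+1| = \sum_v 'C(p v, t) ->
   [/\ M = \sum_(v in S) 'C(p v, t),
       t.+1 * #|cliques e' t.+1| = \sum_v 'C(p' v, t)
     & forall v, v \notin S -> 'C(p' v, t) = 'C(p v, t)]).
Proof.
move=> t_gt0 e' p p' M leM leK'.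
have leK : t.+1 * #|cliques e t.+1| <= M + t.+1 * #|cliques e' t.+1|.
  by rewrite -mulnDr leq_mul2l card_cliques_isolate orbT.
have p'S : \sum_(v in S) 'C(p' v, t) = 0.
  rewrite big1 // => v vS; rewrite /p' longest_path_isolated ?bin0n ?eqn0Ngt ?t_gt0 //.
  - by move=> x; rewrite /e' /isolate vS !andbF.
  - by move=> x; rewrite /e' /isolate vS !andbF.
have splitS (f : T -> nat) : \sum_v f v = \sum_(v in S) f v + \sum_(v | v \notin S) f v.
  exact: bigID.
have [le_p eq_p] : \sum_(v | v \notin S) 'C(p' v, t) <= \sum_(v | v \notin S) 'C(p v, t)
    ?= iff [forall (v | v \notin S), 'C(p' v, t) == 'C(p v, t)].
  by apply: leqif_sum => v _; apply/leqif_eq/leq_bin2l/longest_path_sub/isolate_sub.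
move: leK'; rewrite !splitS p'S add0n => leK'.
(* The bound chains [leK], [leM], [leK'] and [le_p]; equality between its two ends makes every link
   tight. *)
split=> [|eqK]; first by lia.
split; [lia|lia|].
have /eqP : \sum_(v | v \notin S) 'C(p' v, t) = \sum_(v | v \notin S) 'C(p v, t) by lia.
by rewrite eq_p => /forall_inP H v vS; apply/eqP/H.
Qed.

End CliqueCounting.

(** * The induction for the bound and its equality case *)

Section CliqueBound.
Variable T : finType.
Implicit Types (e : rel T) (A S : {set T}) (q : seq T).

(** Only one direction of the equality case travels with the bound; the other is [trans_on_cliques],
    which needs no induction. Scaling by [t.+1] keeps everything in [nat]. *)
Definition clique_bound e t :=
  t.+1 * #|cliques e t.+1| <= \sum_v 'C(longest_path e v, t) /\
  (t.+1 * #|cliques e t.+1| = \sum_v 'C(longest_path e v, t) -> trans_on e t).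

Lemma clique_bound_closed e t k q : symmetric e -> 0 < t ->
  (forall q', sorted e q' -> uniq q' -> size q' <= k.+1) ->
  sorted e q -> uniq q -> size q = k.+1 ->
  (forall a b, a \in q -> e a b -> b \in q) ->
  clique_bound (isolate e [set x in q]) t -> clique_bound e t.
Proof.
move=> e_sym t_gt0 k_max e_q u_q sq closed [leK' eqK'].
set S := [set x in q] in leK' eqK' *.
have cS : #|S| = k.+1 by rewrite cardsE (card_uniqP u_q).
have pS v : v \in S -> longest_path e v = k.
  rewrite inE => vq; have := leq_longest_path e_q u_q vq.
  have [q' [e_q' u_q' _ sq']] := longest_path_witness e v.
  by have := k_max q' e_q' u_q'; rewrite sq sq'; lia.
have closedS a b : e a b -> (a \in S) = (b \in S).
  move=> eab; rewrite !inE; apply/idP/idP => [aq|bq]; first exact: closed eab.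
  by apply: closed bq _; rewrite e_sym.
have sumS : \sum_(v in S) 'C(longest_path e v, t) = t.+1 * 'C(k.+1, t.+1).
  rewrite (eq_bigr (fun=> 'C(k, t))) => [|v /pS -> //].
  by rewrite sum_nat_const cS mul_bin_diag.
have meet_sub : cliques_meeting e t.+1 S \subset [set A : {set T} | A \subset S & #|A| == t.+1].
  apply/subsetP => A; rewrite !inE => /andP[/andP[-> /cliqueP clA]].
  case/pred0Pn=> a /andP[/= aA aS]; rewrite andbT; apply/subsetP => b bA.
  by case: (eqVneq a b) => [<- //|nab]; rewrite -(closedS a) // clA.
have leM : t.+1 * #|cliques_meeting e t.+1 S| <= \sum_(v in S) 'C(longest_path e v, t).
  by rewrite sumS leq_mul2l -cS -cards_draws subset_leq_card ?orbT.
have [le_e eq_e] := isolate_bound t_gt0 leM leK'.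
split=> // /eq_e [eqM /eqK' tr' eq_p] x y z px py pz exy eyz nxz.
have [yS|yNS] := boolP (y \in S); last first.
  have xNS : x \notin S by rewrite (closedS _ _ exy).
  have zNS : z \notin S by rewrite -(closedS _ _ eyz).
  (* Equal binomials suffice here: ['C(p, t)] is positive exactly when [t <= p]. *)
  have p' v : v \notin S -> t <= longest_path e v -> t <= longest_path (isolate e S) v.
    by move=> vNS; rewrite -bin_gt0 -eq_p // bin_gt0.
  apply: (@isolate_sub _ e S); apply: (tr' x y z) => //; try exact: p'.
  - by rewrite /isolate exy xNS.
  - by rewrite /isolate eyz yNS.
have xS : x \in S by rewrite (closedS _ _ exy).
have zS : z \in S by rewrite -(closedS _ _ eyz).
(* Tightness on [S] means that every [t.+1]-subset of [S] is a clique. *)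
have eq_meet : cliques_meeting e t.+1 S = [set A : {set T} | A \subset S & #|A| == t.+1].
  apply/eqP; rewrite eqEcard meet_sub cards_draws cS -(leq_pmul2l (ltn0Sn t)).
  by rewrite eqM sumS leqnn.
have xzS : [set x; z] \subset S by rewrite subUset !sub1set xS zS.
(* To see that [x] and [z] are adjacent, complete them to a [t.+1]-subset of [S]; the [t.-1] further
   vertices exist because [t <= k]. *)
have /card_gt0P[B] : 0 < #|[set B : {set T} | B \subset S :\: [set x; z] & #|B| == t.-1]|.
  rewrite cards_draws bin_gt0 cardsD (setIidPr xzS) cS cards2 nxz.
  by rewrite (pS y) // in py; lia.
rewrite inE => /andP[]; rewrite subsetD => /andP[BS disj] /eqP sB.
have : [set x; z] :|: B \in cliques_meeting e t.+1 S.
  rewrite eq_meet inE subUset xzS BS /= cardsU setIC (disjoint_setI0 disj) cards0.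
  by rewrite cards2 nxz sB subn0; apply/eqP; lia.
rewrite !inE => /andP[/andP[_ /cliqueP cl] _].
by apply: cl; rewrite ?inE ?eqxx ?orbT.
Qed.

Lemma clique_bound_end e t k x y q : symmetric e -> irreflexive e -> 0 < t ->
  (forall q', sorted e q' -> uniq q' -> size q' <= k.+1) ->
  sorted e [:: x, y & q] -> uniq [:: x, y & q] -> size q = k.-1 -> 0 < k ->
  (#|nbh e x|).*2 <= k ->
  clique_bound (isolate e [set x]) t -> clique_bound e t.
Proof.
move=> e_sym e_irr t_gt0 k_max e_q u_q sq k_gt0 deg_x [leK' eqK'].
set e' := isolate e [set x] in leK' eqK' *.
have p_le v : longest_path e v <= k.
  by have [q' [e_q' u_q' _ sq']] := longest_path_witness e v; rewrite -ltnS -sq' k_max.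
have p_q v : v \in [:: x, y & q] -> longest_path e v = k.
  move=> vq; apply/eqP; rewrite eqn_leq p_le /=.
  by have := leq_longest_path e_q u_q vq; rewrite /= sq prednK.
have leM : t.+1 * #|cliques_meeting e t.+1 [set x]|
    <= \sum_(v in [set x]) 'C(longest_path e v, t).
  (* With d the degree of [x], the chain is [t.+1 * 'C(d, t) <= 'C(d.*2, t) <= 'C(k, t)]. *)
  rewrite big_set1 p_q ?inE ?eqxx //; apply: leq_trans (leq_bin2l t deg_x).
  apply: leq_trans (leq_mul_bin_double _ t); rewrite leq_mul2l /=.
  apply: leq_trans (card_cliques_at e t x); apply: subset_leq_card.
  apply/subsetP => A; rewrite !inE => /andP[-> ] /=.
  by case/pred0Pn=> a /andP[/= aA]; rewrite inE => /eqP <-.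
have [le_e eq_e] := isolate_bound t_gt0 leM leK'.
(* Equality is refuted as soon as one vertex, here [x0], gives [t <= k]; so the conclusion about
   [x0] and [z0] is replaced by a contradiction. *)
split=> // /eq_e [_ /eqK' tr' eq_p] x0 y0 z0 px0 *; apply: contraT => _.
have le_tk : t <= k := leq_trans px0 (p_le x0).
have e'_sym : symmetric e' by apply: isolate_sym.
have nyx : y != x by case/andP: u_q; rewrite inE negb_or eq_sym => /andP[].
(* As [t <= k], a drop below [k] would strictly lower the binomial of [y]. *)
have p'y : longest_path e' y = k.
  apply/eqP; rewrite eqn_leq; apply/andP; split.
    by apply: leq_trans (p_le y); apply/longest_path_sub/isolate_sub.
  rewrite leqNgt; apply/negP => /(ltn_bin2l t_gt0 le_tk).
  by rewrite eq_p ?inE // p_q ?inE ?eqxx ?orbT // ltnn.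
have [q' [e'_q' u_q' yq' sq']] := longest_path_witness e' y.
rewrite p'y in sq'.
have cl : {in q' &, forall a b, a != b -> e' a b}.
  by apply: trans_on_path tr' e'_q' u_q' _ => //; rewrite sq' ltnS.
have xNq' : x \notin q'.
  apply/negP => xq'; have := cl _ _ xq' yq'; rewrite eq_sym => /(_ nyx) /and3P[_].
  by rewrite inE eqxx.
have perm_q' := perm_to_rem yq'.
(* The clique on [q'] can be traversed from [y] in any order, so prepending [x] gives a path with
   [k.+2] vertices. *)
have := k_max [:: x, y & rem y q'].
rewrite [size _]/= -(perm_size perm_q' : _ = (size (rem y q')).+1) sq' ltnn.
apply.
- have : sorted e (y :: rem y q').
    apply: clique_sorted; first by rewrite -(perm_uniq perm_q').
    move=> a b; rewrite -!(perm_mem perm_q') => aq bq nab.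
    exact/isolate_sub/cl.
  by case/andP: e_q => exy _ /=; rewrite exy.
- by rewrite cons_uniq -(perm_mem perm_q') -(perm_uniq perm_q') xNq'.
Qed.

Lemma clique_boundP e t :
  symmetric e -> irreflexive e -> 0 < t -> clique_bound e t.
Proof.
move=> e_sym e_irr t_gt0.
(* The induction measure counts ordered adjacent pairs, and it drops whenever a vertex with a
   neighbour is isolated. *)
have [n] := ubnP #|[set a : T * T | e a.1 a.2]|.
elim: n e e_sym e_irr => // n IHn e e_sym e_irr; rewrite ltnS => le_n.
have IH S x y : x \in S -> e x y -> clique_bound (isolate e S) t.
  move=> xS exy; apply: IHn.
  - exact: isolate_sym.
  - by move=> v; rewrite /isolate e_irr.
  apply: leq_trans le_n; apply: proper_card; apply/properP; split.
    by apply/subsetP => a; rewrite !inE => /isolate_sub.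
  by exists (x, y); rewrite inE //= /isolate xS andbF.
have [/pred0P edge0|/pred0Pn[[a b] /= eab]] := boolP (pred0b [pred a : T * T | e a.1 a.2]).
  have no_e x y : e x y = false by apply: (edge0 (x, y)).
  split=> [|_ x y z _ _ _ exy]; last by rewrite no_e in exy.
  suff -> : cliques e t.+1 = set0 by rewrite cards0 muln0.
  apply/setP => A; rewrite !inE; apply/negbTE/negP => /andP[/eqP sA /cliqueP clA].
  have /card_gt1P[x [y [xA yA nxy]]] : 1 < #|A| by rewrite sA ltnS.
  by have := clA x y xA yA nxy; rewrite no_e.
(* A vertex maximizing [longest_path e] lies on a longest path of the whole graph. *)
case: (@arg_maxnP T a predT (longest_path e)) => // v _ v_max.
pose k := longest_path e v.
have k_max q : sorted e q -> uniq q -> size q <= k.+1.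
  case: q => [|x q] // e_q u_q.
  by apply: leq_trans (leq_longest_path e_q u_q (mem_head x q)) _; rewrite ltnS; apply: v_max.
have k_gt0 : 0 < k.
  have := k_max [:: a; b]; rewrite /= eab inE => /(_ isT); rewrite ltnS; apply.
  by rewrite andbT; apply: contraTneq eab => ->; rewrite e_irr.
have [q [e_q u_q _ sq]] := longest_path_witness e v.
have [closed|[x [p [e_p u_p sp deg_x]]]] := longest_path_dichotomy e_sym e_irr k_max e_q u_q sq.
  apply: (clique_bound_closed e_sym t_gt0 k_max e_q u_q sq closed).
  case: q e_q sq {u_q closed} => [|x [|y q]] //=; first by move=> _ [] k0; rewrite /k -k0 in k_gt0.
  by case/andP=> exy _ _; apply: IH exy; rewrite !inE eqxx.
case: p e_p u_p sp => [|y p] e_p u_p sp; first by rewrite -sp in k_gt0.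
apply: (clique_bound_end e_sym e_irr t_gt0 k_max e_p u_p _ k_gt0 deg_x).
  by rewrite -sp.
by case/andP: e_p => exy _; apply: IH exy; rewrite !inE eqxx.
Qed.

(** Transitivity contracts a walk inside [H] to an edge or a single vertex; conversely, [x] and [z]
    both lie in the component of [y]. *)
Lemma trans_on_components e t : symmetric e ->
  let H := [set v : T | t <= longest_path e v] in
  trans_on e t <->
  (forall C, C \in components (induced e H) -> is_clique (induced e H) C).
Proof.
move=> e_sym H; set r := induced e H.
have r_sym : symmetric r by move=> x y; rewrite /r /induced /= e_sym.
split=> [tr C /imsetP[w _ ->] x y|cl x y z px py pz exy eyz nxz].
  rewrite !inE => wx wy nxy.
  have /connectP[q r_q yE] : connect r x y.
    by apply: connect_trans wy; rewrite (sym_connect_sym r_sym).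
  suff : (x == y) || r x y by rewrite (negPf nxy).
  elim: q x r_q yE {wx nxy} => [|z q IHq] x /=; first by move=> _ ->; rewrite eqxx.
  case/andP=> rxz r_q yE; have /predU1P[<-|rzy] := IHq z r_q yE; first by rewrite rxz orbT.
  case: eqVneq => //= nxy; move: (valP x) (valP y) (valP z); rewrite !inE => px py pz.
  exact: tr px pz py rxz rzy nxy.
have [xH yH zH] : [/\ x \in H, y \in H & z \in H] by rewrite !inE.
pose cls := [set b in [set: {v | v \in H}] | connect r (Sub y yH) b].
have clsC : cls \in components r by apply/imsetP; exists (Sub y yH); rewrite ?inE.
apply: (cl _ clsC (Sub x xH) (Sub z zH)).
- by rewrite !inE connect1 // /r /induced /= e_sym.
- by rewrite !inE connect1.
- by apply: contra nxz => /eqP[->].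
Qed.
End CliqueBound.

Lemma card_cliques1 (T : finType) (e : rel T) : #|cliques e 1| = #|T|.
Proof.
rewrite -cardsT -(card_imset _ (@set1_inj T)); apply: eq_card => A.
rewrite inE; apply/andP/imsetP => [[/cards1P[x ->] _]|[x _ ->]]; first by exists x.
by rewrite cards1; split=> //; apply/cliqueP => a b /set1P-> /set1P->; rewrite eqxx.
Qed.

(** * Transfer to the rationals *)

Import Order.TTheory GRing.Theory Num.Theory.
Local Open Scope ring_scope.

Theorem theorem2p7 (T : finType) (e : rel T)
    (e_sym : symmetric e) (e_irr : irreflexive e)
    (s : nat) (s_ge1 : (1 <= s)%N) :
  let p := longest_path e in
  let N : rat := (num_copies e (complete_graph s))%:R in
  let B : rat := \sum_(v : T) 1 / (p v + 1)%:R * 'C(p v + 1, s)%:R in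
  let Hp := [set v : T | (s - 1 <= p v)%N] in
  [/\ N <= B,
      B = 1 / s%:R * \sum_(v : T) 'C(p v, s - 1)%:R,
      s = 1%N -> N = B
    & (2 <= s)%N ->
      (N = B <-> forall C, C \in components (induced e Hp) ->
                           is_clique (induced e Hp) C)].
Proof.
case: s s_ge1 => // t _ p N B Hp; rewrite subn1 /=.
have t1_neq0 : t.+1%:R != 0 :> rat by rewrite pnatr_eq0.
(* Termwise this is [(p v).+1 * 'C(p v, t) = t.+1 * 'C((p v).+1, t.+1)]. *)
have BE : B = 1 / t.+1%:R * \sum_(v : T) 'C(p v, t)%:R.
  rewrite mulr_sumr; apply: eq_bigr => v _; rewrite addn1 !mul1r.
  have p1_neq0 : (p v).+1%:R != 0 :> rat by rewrite pnatr_eq0.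
  apply: (mulfI p1_neq0); rewrite mulVKf // mulrCA -natrM mul_bin_diag natrM.
  by rewrite mulKf.
have B_sum : t.+1%:R * B = (\sum_v 'C(p v, t))%N%:R.
  by rewrite BE mul1r mulVKf // natr_sum.
have N_card : t.+1%:R * N = (t.+1 * #|cliques e t.+1|)%N%:R.
  by rewrite /N num_copiesE // natrM.
have leNB : (N <= B) = (t.+1 * #|cliques e t.+1| <= \sum_v 'C(p v, t))%N.
  by rewrite -(ler_nat rat) -N_card -B_sum ler_pM2l // ltr0n.
have eqNB : N = B <-> (t.+1 * #|cliques e t.+1| = \sum_v 'C(p v, t))%N.
  split=> [NB|KB]; last by apply: (mulfI t1_neq0); rewrite N_card KB B_sum.
  by apply/eqP; rewrite -(eqr_nat rat) -N_card -B_sum NB.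
(* For s = 1 both sides count the vertices; this case is separate since [clique_boundP] assumes
   [0 < t]. *)
have eq1 : t = 0%N -> N = B.
  move=> t0; apply/eqNB; rewrite t0 mul1n card_cliques1.
  by rewrite (eq_bigr (fun=> 1%N)) ?sum1_card // => v _; rewrite bin0.
have HpE : Hp = [set v | t <= longest_path e v]%N by rewrite /Hp subn1.
split=> // [|[]//|].
  have [t0|t_gt0] := posnP t; first by rewrite eq1.
  by rewrite leNB; have [] := clique_boundP e_sym e_irr t_gt0.
rewrite ltnS => t_gt0; have [leK eqK] := clique_boundP e_sym e_irr t_gt0.
rewrite HpE; apply: iff_trans eqNB _; apply: iff_trans (trans_on_components t e_sym).
split=> // tr; apply/eqP; rewrite eqn_leq leK; exact: trans_on_cliques.
Qed.
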